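(* The numbers $e(D_r(\mathcal B_n))$ satisfy the recurrence $$e(D_n(\mathcal B_n))=1,\qquad e(D_0(\mathcal B_n))=\begin{cases}\big((n-1)!!\big)^2&\text{if $n$ is even}\\0&\text{if $n$ is odd,}\end{cases}$$ and, for $n\ge1$ and $1\le r\le n-1$, $$e(D_r(\mathcal B_n))=\sum_{i=1}^{\lfloor\frac n2\rfloor}\binom{n-1}{2i-1}(2i-1)!\;e(D_r(\mathcal B_{n-2i}))+\sum_{i=0}^{\lfloor\frac{n-1}2\rfloor}\binom{n-1}{2i}(2i+1)!\;e(D_{r-1}(\mathcal B_{n-2i-1})).$$
   Context: Write $\mathbf n=\{1,\dots,n\}$ and let $\mathbf n'$ be a disjoint copy. The Brauer monoid $\mathcal B_n$ is the set of all set partitions $\alpha$ of $\mathbf n\cup\mathbf n'$ into blocks of size exactly $2$ ($\mathcal B_0=\{\emptyset\}$). Product: for $\alpha,\beta\in\mathcal B_n$ take a third copy $\mathbf n''$; relabel each lower vertex $x'$ of $\alpha$ as $x''$ and each upper vertex $x$ of $\beta$ as $x''$, and take the union graph $\Gamma(\alpha,\beta)$ on $\mathbf n\cup\mathbf n'\cup\mathbf n''$ (blocks being viewed as edges); $x,y\in\mathbf n\cup\mathbf n'$ are in the same block of $\alpha\beta$ iff they are joined by a path in $\Gamma(\alpha,\beta)$. The rank of $\alpha$ is the number of blocks meeting both $\mathbf n$ and $\mathbf n'$, and $D_r(\mathcal B_n)=\{\alpha\in\mathcal B_n:\operatorname{rank}(\alpha)=r\}$ (empty if $r>n$). For $\Sigma\subseteq\mathcal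 B_n$, $e(\Sigma)$ is the number of $\alpha\in\Sigma$ with $\alpha^2=\alpha$. For odd $k$, $k!!=k(k-2)\cdots3\cdot1$, with $(-1)!!=1$. *)

(* Defs.v *)
From mathcomp Require Import all_boot.

Set Implicit Arguments.
Unset Strict Implicit.
Unset Printing Implicit Defensive.

(* The vertices: [inl x] is x in the upper row, [inr x] is x' in the lower row;
   the labels are 0, ..., n-1 instead of 1, ..., n. *)
Definition vertex (n : nat) : finType := ('I_n + 'I_n)%type.

Definition is_upper (n : nat) (v : vertex n) : bool :=
  if v is inl _ then true else false.

Definition brauer (n : nat) : {set {set {set vertex n}}} :=
  [set a | partition a [set: vertex n] & [forall B in a, #|B| == 2]].

(* The vertices of the product graph: [inl v] is an outer vertex v, and
   [inr x] is the middle vertex x''. *)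
Definition gvertex (n : nat) : finType := (vertex n + 'I_n)%type.

Definition lower_to_mid (n : nat) (v : vertex n) : gvertex n :=
  match v with inl x => inl (inl x) | inr x => inr x end.

Definition upper_to_mid (n : nat) (v : vertex n) : gvertex n :=
  match v with inl x => inr x | inr x => inl (inr x) end.

Definition graph_edges (n : nat) (a b : {set {set vertex n}}) :
    {set {set gvertex n}} :=
  [set @lower_to_mid n @: B | B : {set vertex n} in a]
    :|: [set @upper_to_mid n @: B | B : {set vertex n} in b].

Definition graph_adj (n : nat) (a b : {set {set vertex n}}) : rel (gvertex n) :=
  fun u w => [set u; w] \in graph_edges a b.

(* [connect] is the existence of a path, so x and y are in the same block iff
   they are joined by a path in the product graph. *)
Definition brauer_mul (n : nat) (a b : {set {set vertex n}}) :
    {set {set vertex n}} :=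
  equivalence_partition
    (fun x y : vertex n => connect (graph_adj a b) (inl x) (inl y))
    [set: vertex n].

Definition rank (n : nat) (a : {set {set vertex n}}) : nat :=
  #|[set B in a | [exists v in B, is_upper v] && [exists v in B, ~~ is_upper v]]|.

Definition brauer_D (n r : nat) : {set {set {set vertex n}}} :=
  [set a in brauer n | rank a == r].

Definition num_idem (n : nat) (S : {set {set {set vertex n}}}) : nat :=
  #|[set a in S | brauer_mul a a == a]|.

(* For odd k this is k!!.  Since predecessor on nat is truncated, the value
   [dfact 0 = 1] plays the role of (-1)!! when (n-1)!! is written
   [dfact n.-1] with n = 0. *)
Fixpoint dfact (k : nat) : nat :=
  if k is k'.+2 then k * dfact k' else 1.

(* Main.v *)
Require Import Defs.
From mathcomp Require Import all_boot.
From mathcomp Require Import zify.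

(** An element of the Brauer monoid is a fixed-point-free involution [f] of the
    vertices.  The idempotents are recognised on the labels: join two labels
    when [f] pairs their upper vertices or pairs their lower vertices.  Every
    label then has at most one edge of each kind, so the components are
    alternating cycles and alternating paths.  In the square of the element, a
    path of the product graph that crosses the middle row runs along one such
    alternating path from end to end.  Hence the element is idempotent exactly
    when every transversal joins the two ends of one and the same path, one end
    being free in the upper row and the other in the lower row; such a path has
    an odd number of labels.  So an idempotent of rank [r] is a decomposition of the
    labels into alternating cycles of even length and [r] alternating paths of
    odd length ([brauer_mul_blocks], [rank_blocks]).

    Cycles and paths are both written as one sequence of labels [v_0, ..., v_(m-1)]
    without repetition, a [loop]: the lower vertices of [v_0] and [v_1] are
    paired, then the upper vertices of [v_1] and [v_2], and so on, and the last
    edge returns to the upper vertex of [v_0].  It is a transversal exactly when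
    [m] is odd.

    The recurrence removes the loop of a chosen label [z]
    ([num_loop_matchings_rec]).  An odd loop has a well-defined first label, and
    an even one may be started at [z]; with this convention the loop of [z] is
    unique ([loop_unique]), and what remains is an arbitrary decomposition of the
    other labels ([card_loop_matchings_following]).  Among [n] labels, the possible
    loops of [z] of length [m] number [(n-1)(n-2)...(n-m+1)] when [m] is even, and [m] times
    that when [m] is odd, because [z] may stand at any position ([card_rooted]).

    In rank [0] only even loops occur, and comparing the recurrences for [n + 2]
    and for [n] turns the sum into [e(n + 2) = (n + 1)^2 e(n)]; in rank [n] only
    loops of length [1] survive. *)

Set Implicit Arguments.
Unset Strict Implicit.
Unset Printing Implicit Defensive.

(** * Loops on two rows of points *)

Section Loops.
Variable T : finType.
Implicit Types (y : T + T) (s : seq T) (S : {set T}).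

Definition label y : T := match y with inl x => x | inr x => x end.
Definition lower y : bool := if y is inr _ then true else false.
Definition pt (b : bool) (x : T) : T + T := if b then inr x else inl x.

Lemma label_pt b x : label (pt b x) = x. Proof. by case: b. Qed.
Lemma lower_pt b x : lower (pt b x) = b. Proof. by case: b. Qed.
Lemma pt_eta y : pt (lower y) (label y) = y. Proof. by case: y. Qed.

(** The matching prescribed by a loop [s = v_0, ..., v_(m-1)]: the edge between
    [v_i] and [v_(i+1)] lies in the lower row for even [i] and in the upper row
    for odd [i], and the closing edge joins the vertex of [v_(m-1)] that is still
    free to the upper vertex of [v_0].  The value means nothing when the label
    of [y] is not in [s]. *)
Definition mate s y : T + T :=
  let i := index (label y) s in
  if lower y != odd i then
    if i.+1 < size s then pt (lower y) (nth (label y) s i.+1)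
    else inl (head (label y) s)
  else if i is j.+1 then pt (lower y) (nth (label y) s j)
  else pt (odd (size s)) (last (label y) s).

(** The vertices over [s], sorted by the edge of [mate s] that they end.  The
    default [z] is never read when [s] is not empty. *)
Variant edge_spec z s y : Prop :=
| EdgeFwd i of i.+1 < size s & y = pt (~~ odd i) (nth z s i)
| EdgeBwd i of i.+1 < size s & y = pt (~~ odd i) (nth z s i.+1)
| EdgeLast of y = pt (odd (size s)) (last z s)
| EdgeHead of y = inl (head z s).

Lemma edgeP z s y : label y \in s -> edge_spec z s y.
Proof.
move=> ys; rewrite -(pt_eta y); set i := index (label y) s.
have im : i < size s by rewrite index_mem.
have yE : label y = nth z s i by rewrite nth_index.
rewrite yE; case: (eqVneq (lower y) (odd i)) => [->|].
  case: i im {yE} => [|i] im; first by apply: EdgeHead; rewrite nth0.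
  exact: EdgeBwd im erefl.
move=> neq; have -> : lower y = ~~ odd i by case: (lower y) (odd i) neq => [] [].
have [lt|ge] := ltnP i.+1 (size s); first exact: EdgeFwd lt erefl.
have eqm : size s = i.+1 by lia.
by apply: EdgeLast; rewrite -nth_last eqm.
Qed.

Lemma mate_fwd z s i : uniq s -> i.+1 < size s ->
  mate s (pt (~~ odd i) (nth z s i)) = pt (~~ odd i) (nth z s i.+1).
Proof.
move=> us im; rewrite /mate label_pt lower_pt index_uniq ?(ltnW im) // im.
by case: (odd i); rewrite /= (set_nth_default z).
Qed.

Lemma mate_bwd z s i : uniq s -> i.+1 < size s ->
  mate s (pt (~~ odd i) (nth z s i.+1)) = pt (~~ odd i) (nth z s i).
Proof.
move=> us im; rewrite /mate label_pt lower_pt index_uniq //= eqxx /=.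
by rewrite (set_nth_default z) // ltnW.
Qed.

Lemma mate_last z s : uniq s -> 0 < size s ->
  mate s (pt (odd (size s)) (last z s)) = inl (head z s).
Proof.
case szs: (size s) => [//|k] us _; rewrite /mate label_pt lower_pt -nth_last szs.
rewrite index_uniq ?szs //= ltnn.
by case: (odd k); case: (s) szs.
Qed.

Lemma mate_head z s : uniq s -> 0 < size s ->
  mate s (inl (head z s)) = pt (odd (size s)) (last z s).
Proof. by case: s => // x s us _; rewrite /mate /= eqxx. Qed.

Lemma label_mate s y : uniq s -> label y \in s -> label (mate s y) \in s.
Proof.
move=> us ys; have m0 : 0 < size s by case: s {us} ys.
case: (edgeP (label y) ys) => [i im|i im||] ->.
- by rewrite mate_fwd // label_pt mem_nth.
- by rewrite mate_bwd // label_pt mem_nth // ltnW.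
- by rewrite mate_last //= -nth0 mem_nth.
- by rewrite mate_head //= label_pt -nth_last mem_nth // prednK.
Qed.

Lemma mateK s y : uniq s -> label y \in s -> mate s (mate s y) = y.
Proof.
move=> us ys; have m0 : 0 < size s by case: s {us} ys.
case: (edgeP (label y) ys) => [i im|i im||] ->.
- by rewrite mate_fwd // mate_bwd.
- by rewrite mate_bwd // mate_fwd.
- by rewrite mate_last // mate_head.
- by rewrite mate_head // mate_last.
Qed.

Lemma mate_neq s y : uniq s -> label y \in s -> mate s y != y.
Proof.
move=> us ys; have m0 : 0 < size s by case: s {us} ys.
have ends z : pt (odd (size s)) (last z s) != inl (head z s).
  apply/eqP => E; have := congr1 lower E; rewrite lower_pt /= => ev.
  have := congr1 label E; rewrite label_pt /= -nth_last -nth0 => /eqP.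
  by rewrite nth_uniq ?prednK //; lia.
case: (edgeP (label y) ys) => [i im|i im||] ->.
- rewrite mate_fwd //; apply/eqP => /(congr1 label)/eqP.
  by rewrite !label_pt nth_uniq ?(ltnW im) //; lia.
- rewrite mate_bwd //; apply/eqP => /(congr1 label)/eqP.
  by rewrite !label_pt nth_uniq ?(ltnW im) //; lia.
- by rewrite mate_last // eq_sym.
- by rewrite mate_head.
Qed.

(** Only the closing edge can join the two rows, and it starts at the upper
    vertex of the first label. *)
Lemma lower_mate_upper z s x : uniq s -> x \in s ->
  lower (mate s (inl x)) = odd (size s) && (x == head z s).
Proof.
move=> us xs; have m0 : 0 < size s by case: s {us} xs.
case: (edgeP z (y := inl x) xs) => [i im E|i im E|E|[E]].
- rewrite E mate_fwd // lower_pt; move: E.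
  case: (boolP (odd i)) => //= oi [->].
  by rewrite -nth0 nth_uniq ?(ltnW im) // (_ : i == 0 = false) ?andbF //; lia.
- rewrite E mate_bwd // lower_pt; move: E.
  case: (boolP (odd i)) => //= oi [->].
  by rewrite -nth0 nth_uniq // ?andbF.
- by rewrite E mate_last //=; move: E; case: (odd (size s)).
- by rewrite E mate_head // lower_pt eqxx andbT.
Qed.

Implicit Type f : {ffun T + T -> T + T}.

(** The matchings of the vertices over [S], extended by the identity: this keeps
    the matchings on all subsets of [T] in one type. *)
Definition matching S f : bool :=
  [forall y, (f (f y) == y) && ((f y == y) == (label y \notin S))].

Definition follows s f : bool :=
  [forall y, (label y \in s) ==> (f y == mate s y)].

Definition loop s f : bool := uniq s && follows s f.

(** The tuples and the bound on their length only serve to make this a boolean;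
    see [loopedP]. *)
Definition looped S f : bool :=
  [forall x in S, [exists m : 'I_#|T|.+1, [exists t : m.-tuple T,
     (x \in t) && loop t f]]].

Lemma matchingK S f : matching S f -> involutive f.
Proof. by move=> /forallP h y; have /andP[/eqP] := h y. Qed.

Lemma matching_fix S f y : matching S f -> (f y == y) = (label y \notin S).
Proof. by move=> /forallP /(_ y) /andP[_ /eqP]. Qed.

Lemma followsP s f :
  reflect (forall y, label y \in s -> f y = mate s y) (follows s f).
Proof.
apply: (iffP forallP) => h y; first by move=> ys; apply/eqP/(implyP (h y)).
by apply/implyP => /h ->.
Qed.

Lemma loopedP S f :
  reflect (forall x, x \in S -> exists2 s : seq T, x \in s & loop s f)
          (looped S f).
Proof.
apply: (iffP forall_inP) => h x /h.
  by case/existsP => m /existsP[t /andP[xt lt]]; exists t.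
case=> s xs ls; have sm : size s < #|T|.+1.
  by case/andP: ls => us _; rewrite ltnS -(card_uniqP us) max_card.
by apply/existsP; exists (Ordinal sm); apply/existsP; exists (in_tuple s); apply/andP.
Qed.

Lemma loop_sub S f s : matching S f -> loop s f -> {subset s <= S}.
Proof.
move=> mf /andP[us /followsP fs] x xs.
by have := matching_fix (inl x) mf; rewrite fs // (negPf (mate_neq _ _)) //= => /esym/negbFE.
Qed.

Definition crossing f y : bool := lower (f y) != lower y.

Lemma crossing_f f y : involutive f -> crossing f (f y) = crossing f y.
Proof. by move=> fK; rewrite /crossing fK eq_sym. Qed.

(** A loop is connected by the edges that stay in one row, because cutting it at
    the closing edge leaves a path. *)
Lemma loop_sub_closed f s (A : pred T) x :
    involutive f -> (forall y, ~~ crossing f y -> A (label y) -> A (label (f y))) ->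
  loop s f -> x \in s -> A x -> {subset s <= A}.
Proof.
move=> fK clA /andP[us /followsP fs] xs Ax.
have step i : i.+1 < size s -> A (nth x s i) = A (nth x s i.+1).
  move=> im; have E : f (pt (~~ odd i) (nth x s i)) = pt (~~ odd i) (nth x s i.+1).
    by rewrite fs ?label_pt ?mem_nth ?mate_fwd // ltnW.
  have nc : ~~ crossing f (pt (~~ odd i) (nth x s i)) by rewrite /crossing E !lower_pt eqxx.
  have := clA _ nc; rewrite E !label_pt => h1.
  rewrite -crossing_f // in nc; have := clA _ nc; rewrite fK E !label_pt => h2.
  exact/idP/idP.
have all0 i : i < size s -> A (nth x s i) = A (nth x s 0).
  by elim: i => // i IH im; rewrite -step // IH // ltnW.
have A0 : A (nth x s 0).
  by rewrite -(all0 (index x s)) ?index_mem // nth_index.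
by move=> w ws; rewrite -(nth_index x ws) unfold_in /= all0 ?index_mem.
Qed.

Lemma loop_closed f s : loop s f -> forall y, label y \in s -> label (f y) \in s.
Proof. by move=> /andP[us /followsP fs] y ys; rewrite fs // label_mate. Qed.

Lemma loop_sub_loop f s s' x : involutive f ->
  loop s f -> loop s' f -> x \in s -> x \in s' -> {subset s <= s'}.
Proof.
move=> fK ls ls' xs xs'.
apply: (@loop_sub_closed f s (mem s') x fK _ ls xs xs') => y _.
exact: (loop_closed ls').
Qed.

(** Two loops through [z] have the same labels since both are connected and
    closed.  If their length is odd, both start at the upper end of the only
    transversal; if it is even, both start at [z].  From there on [f] dictates
    every further label, the first edge being in the lower row. *)
Lemma loop_unique f s s' z : involutive f ->
    loop s f -> loop s' f -> z \in s -> z \in s' ->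
    odd (size s) || (head z s == z) -> odd (size s') || (head z s' == z) ->
  s = s'.
Proof.
move=> fK ls ls' zs zs' hs hs'.
have ss' := loop_sub_loop fK ls ls' zs zs'.
have s's := loop_sub_loop fK ls' ls zs' zs.
have /andP[us /followsP fs] := ls; have /andP[us' /followsP fs'] := ls'.
have szE : size s = size s'.
  by apply/eqP; rewrite eqn_leq !uniq_leq_size.
have m0 : 0 < size s by case: (s) zs.
have m0' : 0 < size s' by rewrite -szE.
have hE : head z s = head z s'.
  move: hs hs'; rewrite -szE; case: (boolP (odd (size s))) => [om _ _|_ /eqP -> /eqP ->] //.
  have hin : head z s \in s by rewrite -nth0 mem_nth.
  have := lower_mate_upper z us hin; rewrite eqxx om -fs //.
  by rewrite fs' ?ss' // (lower_mate_upper z us') ?ss' // -szE om => /eqP.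
apply: (@eq_from_nth _ z) => // i; elim: i => [|i IH] im; first by rewrite !nth0.
have im' := im; rewrite szE in im'.
have := fs (pt (~~ odd i) (nth z s i)).
rewrite label_pt mem_nth ?(ltnW im) // mate_fwd // => /(_ isT).
rewrite IH ?(ltnW im) // fs' ?label_pt ?mem_nth ?(ltnW im') // mate_fwd //.
by move=> /(congr1 label); rewrite !label_pt.
Qed.

Lemma matching_label S f y : matching S f -> (label (f y) \in S) = (label y \in S).
Proof.
move=> mf; apply: negb_inj; rewrite -!(matching_fix _ mf) (matchingK mf).
by rewrite eq_sym.
Qed.

(** * Walking along a matching *)

Definition swap y : T + T := pt (~~ lower y) (label y).

Lemma swapK : involutive swap. Proof. by case. Qed.
Lemma label_swap y : label (swap y) = label y. Proof. by case: y. Qed.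
Lemma lower_swap y : lower (swap y) = ~~ lower y. Proof. by case: y. Qed.

(** The edges of [f] together with the pairs [{y, swap y}] form disjoint cycles;
    [walk f] moves along such a cycle by two edges. *)
Definition walk f y : T + T := f (swap y).

Lemma walk_inj f : involutive f -> injective (walk f).
Proof. by move=> fK; apply: inj_comp; apply: inv_inj => //; apply: swapK. Qed.

Lemma label_walk S f k y : matching S f ->
  (label (iter k (walk f) y) \in S) = (label y \in S).
Proof.
by move=> mf; elim: k => //= k <-; rewrite /walk (matching_label _ mf) label_swap.
Qed.

(** The walk does not traverse a cycle in both directions.  Meeting [swap y]
    after an odd number of steps from [y] means meeting [swap (walk f y)] two
    steps sooner from [walk f y], and in the end [f] would fix a vertex. *)
Lemma walk_neq_swap S f k y : matching S f -> label y \in S ->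
  iter k.*2.+1 (walk f) y != swap y.
Proof.
move=> mf; elim: k y => [|k IH] y yS.
  by rewrite /= /walk (matching_fix _ mf) label_swap yS.
apply: contra (IH (walk f y) _); last by rewrite -[walk f y]/(iter 1 _ y) (label_walk _ _ mf).
rewrite doubleS iterS -iterSr => /eqP/(congr1 f).
by rewrite {1}/walk (matchingK mf) => /(canRL swapK) ->.
Qed.

Lemma lower_walk f x m i : involutive f ->
    (forall j, 0 < j < m -> ~~ crossing f (iter j (walk f) (inl x))) -> i < m ->
  lower (iter i (walk f) (inl x)) = odd i.
Proof.
move=> fK hy; elim: i => // i IH im; have := hy _ (im : 0 < i.+1 < m).
by rewrite /crossing /= {1}/walk fK lower_swap IH 1?ltnW // negbK => /eqP <-.
Qed.

(** While no edge crosses, the walk alternates between the rows, so the labels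
    it visits are in the order required by [mate].  A label visited twice in the
    same row would make the period shorter than [m]; visited in both rows, it
    would contradict [walk_neq_swap]. *)
Lemma walk_loop S f x m : matching S f -> x \in S -> 0 < m ->
    iter m (walk f) (inl x) = inl x ->
    (forall i, 0 < i < m -> ~~ crossing f (iter i (walk f) (inl x))
                            && (iter i (walk f) (inl x) != inl x)) ->
  exists s, [/\ x \in s, loop s f & head x s = x].
Proof.
move=> mf xS m0 ym hy; set y := fun i => iter i (walk f) (inl x).
have fK := matchingK mf.
have yS i : label (y i) \in S by rewrite (label_walk _ _ mf).
have low i : i < m -> lower (y i) = odd i.
  by apply: lower_walk => // j /hy /andP[].
have yE i : i < m -> y i = pt (odd i) (label (y i)).
  by move=> im; rewrite -low // pt_eta.
pose s := mkseq (label \o y) m.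
have sm : size s = m by rewrite size_mkseq.
have snth i : i < m -> nth x s i = label (y i) by move=> im; rewrite nth_mkseq.
have inj i j : i < j -> j < m -> label (y i) != label (y j).
  move=> ij jm; apply/eqP => E; have im := ltn_trans ij jm.
  have yj : y j = iter (j - i) (walk f) (y i) by rewrite /y -iterD subnK // ltnW.
  have [od|ev] := boolP (odd (j - i)).
    have /negP[] := @walk_neq_swap S f (j - i)./2 (y i) mf (yS i).
    have -> : ((j - i)./2).*2.+1 = j - i by lia.
    rewrite -yj (yE j jm) -E (yE i im) /swap label_pt lower_pt.
    by have -> : odd j = ~~ odd i by lia.
  have /andP[_ /negP[]] := hy (j - i) ltac:(lia).
  have E2 : y j = y i by rewrite (yE j jm) (yE i im) E; congr pt; lia.
  have inj_iter : injective (iter i (walk f)).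
    by elim: (i) => //= k IH; apply: inj_comp IH; apply: walk_inj.
  by apply/eqP; apply: inj_iter; rewrite -iterD subnKC ?(ltnW ij).
have us : uniq s.
  apply/(uniqP x) => i j; rewrite !unfold_in sm => im jm /eqP; rewrite !snth // => /eqP E.
  by case: (ltngtP i j) => // /inj; [move/(_ jm)|move/(_ im)]; rewrite E eqxx.
have fwd i : i.+1 < m -> f (pt (~~ odd i) (nth x s i)) = pt (~~ odd i) (nth x s i.+1).
  move=> im; rewrite !snth ?(ltnW im) // -[RHS]/(pt (odd i.+1) _) -yE //.
  by rewrite /y /= /walk -/(y i) /swap low ?(ltnW im).
have hE : head x s = x by rewrite -nth0 snth.
have lastE : f (pt (odd m) (last x s)) = inl x.
  rewrite -nth_last sm snth ?prednK //; rewrite -ym -{1 3}(prednK m0) /= /walk -/(y _).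
  by rewrite /swap low ?prednK.
exists s; split=> //; first by rewrite -{1}hE -nth0 mem_nth ?sm.
rewrite /loop us; apply/followsP => w ws; rewrite -{1}sm in m0.
case: (edgeP x ws) => [i|i||]; rewrite ?sm.
- by move=> im ->; rewrite fwd // mate_fwd ?sm.
- by move=> im ->; rewrite -fwd // fK fwd // mate_bwd ?sm.
- by move=> ->; rewrite lastE -sm mate_last // hE.
- by move=> ->; rewrite mate_head // hE sm -lastE fK.
Qed.

Lemma walk_period f x : involutive f ->
  exists2 m, 0 < m & iter m (walk f) x = x /\
     (forall i, 0 < i < m -> iter i (walk f) x != x).
Proof.
move=> fK; pose P m := (0 < m) && (iter m (walk f) x == x).
have exP : exists m, P m.
  by exists (order (walk f) x); rewrite /P order_gt0 (iter_order (walk_inj fK)) eqxx.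
case: (ex_minnP exP) => m /andP[m0 /eqP ym] min; exists m => //; split=> // i /andP[i0 im].
by apply: contraTN im => yi; rewrite -leqNgt min // /P i0.
Qed.

Lemma crossing_loop_head f s y z : loop s f -> label y \in s -> crossing f y ->
  odd (size s) /\ (y = inl (head z s) \/ y = f (inl (head z s))).
Proof.
move=> /andP[us /followsP fs] ys; rewrite /crossing fs //.
have m0 : 0 < size s by case: (s) ys.
have hs : head z s \in s by rewrite -nth0 mem_nth.
case: (edgeP z ys) => [i im|i im||] -> //.
- by rewrite mate_fwd // !lower_pt eqxx.
- by rewrite mate_bwd // !lower_pt eqxx.
- rewrite mate_last // lower_pt => cr; split; first by case: (odd _) cr.
  by right; rewrite fs // mate_head.
- rewrite mate_head // lower_pt => cr; split; first by case: (odd _) cr.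
  by left.
Qed.

(** An even loop may carry [z] at an odd position, and rotating it would then
    put an upper edge first; walking from [z] gives the right orientation. *)
Lemma loop_rooted S f z : matching S f -> looped S f -> z \in S ->
  exists s, [/\ z \in s, loop s f & odd (size s) || (head z s == z)].
Proof.
move=> mf /loopedP lf zS; have fK := matchingK mf.
have [s zs ls] := lf z zS.
have [os|es] := boolP (odd (size s)); first by exists s; rewrite os.
have [m m0 [ym my]] := walk_period (inl z) fK.
have ys i : label (iter i (walk f) (inl z)) \in s.
  elim: i => //= i IH; rewrite /walk; apply: (loop_closed ls).
  by rewrite label_swap.
have [|t [zt lt ht]] := walk_loop mf zS m0 ym.
  move=> i im; rewrite my // andbT; apply: contra es => cr.
  by have [] := crossing_loop_head z ls (ys i) cr.
by exists t; rewrite ht eqxx orbT.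
Qed.

End Loops.

(** * Removing the loop of a point *)

Section Count.
Variable T : finType.
Implicit Types (y : T + T) (s : seq T) (S : {set T}) (f : {ffun T + T -> T + T}).

Definition transversals f : {set T} := [set x | lower (f (inl x))].

Definition loop_matching S f : bool := matching S f && looped S f.

Definition num_loop_matchings S r : nat := #|[set f | loop_matching S f & #|transversals f| == r]|.

Definition glue s f : {ffun T + T -> T + T} :=
  [ffun y => if label y \in s then mate s y else f y].

Definition detach s f : {ffun T + T -> T + T} :=
  [ffun y => if label y \in s then y else f y].

Lemma loop_matching_detach S f s : loop_matching S f -> loop s f ->
  loop_matching (S :\: [set x in s]) (detach s f).
Proof.
move=> /andP[mf lf] ls; have fK := matchingK mf.
have /andP[us /followsP fs] := ls.
have cl y : label y \notin s -> label (f y) \notin s.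
  by apply: contra => /(loop_closed ls); rewrite fK.
apply/andP; split.
  apply/forallP => y; rewrite !ffunE !inE; have [ys|ys] := boolP (label y \in s).
    by rewrite ys !eqxx.
  by rewrite (negPf (cl _ ys)) fK (matching_fix _ mf) !eqxx.
apply/loopedP => x; rewrite !inE => /andP[xs /(loopedP _ _ lf)[s' xs' ls']].
exists s' => //; have /andP[us' /followsP fs'] := ls'.
rewrite /loop us'; apply/followsP => y ys'; rewrite ffunE ifN ?fs' //.
apply: contra xs => ys.
exact: (loop_sub_loop fK ls' ls ys' ys).
Qed.

Lemma loop_matching_glue S f s : uniq s -> {subset s <= S} ->
  loop_matching (S :\: [set x in s]) f -> loop_matching S (glue s f).
Proof.
move=> us sS /andP[mf lf]; have fK := matchingK mf.
have cl y : label y \notin s -> label (f y) \notin s.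
  move=> ys; have [yS|yS] := boolP (label y \in S).
    have := matching_label y mf; rewrite !inE ys yS.
    by case/andP.
  by have := matching_fix y mf; rewrite !inE (negPf yS) andbF => /eqP ->.
apply/andP; split.
  apply/forallP => y; rewrite !ffunE; have [ys|ys] := boolP (label y \in s).
    by rewrite label_mate // mateK // eqxx (negPf (mate_neq _ _)) // sS.
  by rewrite (negPf (cl _ ys)) fK (matching_fix _ mf) !inE ys !eqxx.
apply/loopedP => x xS; have [xs|xs] := boolP (x \in s).
  exists s => //; rewrite /loop us.
  by apply/followsP => y ys; rewrite ffunE ys.
have [|s' xs' ls'] := loopedP _ _ lf x; first by rewrite !inE xs.
exists s' => //; have /andP[us' /followsP fs'] := ls'.
rewrite /loop us'; apply/followsP => y ys'; rewrite ffunE ifN ?fs' //.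
by have := loop_sub mf ls' ys'; rewrite !inE => /andP[].
Qed.

Lemma card_transversals_glue S f s : uniq s -> matching (S :\: [set x in s]) f ->
  #|transversals (glue s f)| = odd (size s) + #|transversals f|.
Proof.
move=> us mf; rewrite -(cardsID [set x in s] (transversals (glue s f))).
congr (_ + _).
  case: (posnP (size s)) => [/size0nil ->|m0].
    by apply/eqP; rewrite cards_eq0; apply/eqP/setP => x; rewrite !inE andbF.
  have [z _] : exists z, z \in s by case: (s) m0 => // z *; exists z; rewrite mem_head.
  rewrite (_ : _ :&: _ = if odd (size s) then [set head z s] else set0).
    by case: ifP; rewrite ?cards1 ?cards0.
  apply/setP => x; rewrite !inE ffunE /=.
  have [xs|xs] := boolP (x \in s).
    by rewrite andbT (lower_mate_upper z us xs); case: ifP => _; rewrite !inE.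
  rewrite andbF; case: ifP; rewrite !inE // => _; apply/esym/negbTE.
  by apply: contraNneq xs => ->; rewrite -nth0 mem_nth.
congr #|pred_of_set _|; apply/setP => x; rewrite !inE ffunE /=.
case: (boolP (x \in s)) => //= xs.
by have := matching_fix (inl x) mf; rewrite !inE xs => /eqP ->.
Qed.

(** [glue s] is a bijection from the matchings on the rest of [S], with inverse
    [detach s]; the removed loop carried a transversal if its length is odd. *)
Lemma card_loop_matchings_following S s r : uniq s -> {subset s <= S} ->
  #|[set f | loop_matching S f & #|transversals f| == r] :&: [set f | follows s f]| =
  if odd (size s) then if r is r'.+1 then num_loop_matchings (S :\: [set x in s]) r' else 0
  else num_loop_matchings (S :\: [set x in s]) r.
Proof.
move=> us sS; set S' := S :\: _.
transitivity #|[set f | loop_matching S' f & odd (size s) + #|transversals f| == r]|; last first.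
  case: (odd _) => //; case: r => [|r'] //.
  by apply/eqP; rewrite cards_eq0; apply/eqP/setP => f; rewrite !inE andbF.
rewrite -[RHS](card_in_imset (f := glue s)).
  congr #|pred_of_set _|; apply/setP => f; rewrite !inE; apply/idP/imsetP.
    case/andP=> /andP[gf rf] fs; have ls : loop s f by rewrite /loop us.
    have gE : glue s (detach s f) = f.
      apply/ffunP => y; rewrite !ffunE; have [ys|_] := boolP (label y \in s) => //.
      by move: fs => /followsP ->.
    have gd := loop_matching_detach gf ls; exists (detach s f) => //.
    rewrite inE gd; have /andP[md _] := gd.
    by rewrite -(card_transversals_glue us md) gE.
  case=> g; rewrite inE => /andP[gg rg] ->.
  have /andP[mg _] := gg.
  rewrite loop_matching_glue // (card_transversals_glue us mg) rg.
  by apply/followsP => y ys; rewrite ffunE ys.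
move=> g h; rewrite !inE => /andP[/andP[mg _] _] /andP[/andP[mh _] _] /ffunP E.
apply/ffunP => y; have := E y; rewrite !ffunE; case: ifP => // ys _.
have := matching_fix y mg; have := matching_fix y mh.
by rewrite !inE ys => /eqP -> /eqP ->.
Qed.

(** The sequences that can be the loop of [z], with the starting point that
    [loop_unique] requires. *)
Definition rooted m S z : {set m.-tuple T} :=
  [set t : m.-tuple T | [&& uniq t, all (mem S) t, z \in t & odd m || (head z t == z)]].

(** By [loop_rooted] and [loop_unique], every looped matching follows exactly
    one rooted sequence, so the matchings can be sorted by that sequence. *)
Lemma num_loop_matchings_rec S z r : z \in S ->
  num_loop_matchings S r = \sum_(m < #|T|.+1) \sum_(t in rooted m S z)
    if odd m then if r is r'.+1 then num_loop_matchings (S :\: [set x in t]) r' else 0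
    else num_loop_matchings (S :\: [set x in t]) r.
Proof.
move=> zS; set A := [set f | loop_matching S f & #|transversals f| == r].
transitivity (\sum_(f in A) \sum_(m < #|T|.+1) \sum_(t in rooted m S z) follows t f).
  rewrite /num_loop_matchings -/A -sum1_card; apply: eq_bigr => f.
  rewrite inE => /andP[/andP[mf lf] _]; have fK := matchingK mf.
  have [s [zs ls hs]] := loop_rooted mf lf zS; have /andP[us fs] := ls.
  have sm : size s < #|T|.+1 by rewrite ltnS -(card_uniqP us) max_card.
  have uniq_s m (t : m.-tuple T) : t \in rooted m S z -> follows t f -> t = s :> seq T.
    rewrite inE => /and4P[ut _ zt ht] ft.
    by apply: (loop_unique fK (z := z)) => //; rewrite ?size_tuple // /loop ut.
  have sR : in_tuple s \in rooted (size s) S z.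
    by rewrite inE us zs hs; apply/and3P; split=> //; apply/allP/(loop_sub mf ls).
  rewrite (bigD1 (Ordinal sm)) //= (bigD1 (in_tuple s)) //= fs !big1 //.
    move=> m neq; apply: big1 => t tR; apply/eqP; rewrite eqb0.
    apply: contra neq => /(uniq_s _ _ tR) E.
    by apply/eqP/val_inj; rewrite /= -E size_tuple.
  move=> t /andP[tR neq]; apply/eqP; rewrite eqb0.
  by apply: contra neq => /(uniq_s _ _ tR) E; apply/eqP/val_inj.
rewrite exchange_big; apply: eq_bigr => m _; rewrite exchange_big; apply: eq_bigr => t.
rewrite inE => /and4P[ut /allP tS _ _].
have := card_loop_matchings_following r ut tS; rewrite size_tuple => <-.
rewrite -sum1_card big_mkcond [RHS]big_mkcond; apply: eq_bigr => f _.
by rewrite -/A in_setI inE; case: (f \in A); case: (follows t f).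
Qed.

Lemma card_uniq_sub m S :
  #|[set t : m.-tuple T | uniq t && all (mem S) t]| = #|S| ^_ m.
Proof.
rewrite -card_uniq_tuples; apply: eq_card => t; rewrite !inE andbC.
by congr (_ && _).
Qed.

(** For odd length, [z] may stand anywhere: subtract the sequences that avoid [z]
    from all sequences in [S].  For even length, [z] comes first and the other
    entries are free. *)
Lemma card_rooted m S z : z \in S ->
  #|rooted m.+1 S z| = (if odd m then 1 else m.+1) * #|S|.-1 ^_ m.
Proof.
move=> zS; have sz : #|S :\ z| = #|S|.-1 by rewrite (cardsD1 z S) zS.
case: ifP => om; last first.
  pose U (S' : {set T}) := [set t : m.+1.-tuple T | uniq t && all (mem S') t].
  have <- : U S :\: U (S :\ z) = rooted m.+1 S z.
    apply/setP => t; rewrite !inE /= om /= andbT; case: (uniq t) => //=.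
    have [tS|] := boolP (all (mem S) t); rewrite ?andbF //= andbT.
    have -> : all (mem (S :\ z)) t = (z \notin t).
      apply/allP/idP => [h|zt x xt]; first by apply/negP => /h; rewrite !inE eqxx.
      by rewrite /= !inE (allP tS x xt : x \in S) andbT; apply: contraNneq zt => <-.
    by rewrite negbK.
  rewrite cardsDS; last first.
    apply/subsetP => t; rewrite !inE => /andP[-> /allP h].
    by apply/allP => x /h; rewrite !inE => /andP[].
  have eS : #|S| = #|S|.-1.+1 by rewrite prednK //; apply/card_gt0P; exists z.
  rewrite !card_uniq_sub sz {1}eS ffactSS ffactnSr; move: #|S|.-1 => N.
  have [le|gt] := leqP m N; last by rewrite ffact_small // !muln0.
  by rewrite (mulnC _ (N - m)) -mulnBl; congr (_ * _); lia.
rewrite mul1n -sz -card_uniq_sub.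
rewrite -(card_imset _ (f := fun t : m.-tuple T => cons_tuple z t)); last first.
  by move=> t u /(congr1 val) [] /val_inj.
apply: eq_card => t; rewrite !inE /= om /=; apply/idP/imsetP.
  case/tupleP: t => x t /=; rewrite inE => /and4P[ut /andP[_ /allP aS] _ /eqP xz].
  move: ut; rewrite xz => /andP[zt ut]; exists t; last exact: val_inj.
  rewrite inE ut; apply/allP => w wt; rewrite /= !inE (aS w wt : w \in S) andbT.
  by apply: contraNneq zt => <-.
case=> u; rewrite inE => /andP[uu /allP aS] -> /=.
rewrite uu zS !inE eqxx !andbT /=; apply/andP; split.
  by apply/negP => /aS; rewrite !inE eqxx.
by apply/allP => w /aS; rewrite !inE => /andP[].
Qed.

End Count.

(** * The recurrence on cardinalities *)

Lemma num_loop_matchings_set0 (T : finType) r : num_loop_matchings (set0 : {set T}) r = (r == 0).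
Proof.
have fid (f : {ffun T + T -> T + T}) : matching set0 f -> f = [ffun y => y].
  by move=> mf; apply/ffunP => y; have := matching_fix y mf; rewrite inE ffunE => /eqP.
have tid : #|transversals [ffun y : T + T => y]| = 0.
  by apply/eqP; rewrite cards_eq0; apply/eqP/setP => x; rewrite !inE ffunE.
have gid : loop_matching set0 [ffun y : T + T => y].
  apply/andP; split; first by apply/forallP => y; rewrite !ffunE inE !eqxx.
  by apply/loopedP => x; rewrite inE.
rewrite /num_loop_matchings; case: r => [|r] /=.
  rewrite -[RHS](cards1 [ffun y : T + T => y]); apply: eq_card => f; rewrite !inE.
  by apply/andP/eqP => [[/andP[/fid]] | ->] //; rewrite tid.
apply/eqP; rewrite cards_eq0; apply/eqP/setP => f; rewrite !inE.
by apply/negP => /andP[/andP[/fid -> _]]; rewrite tid.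
Qed.

Definition loop_number n r := num_loop_matchings [set: 'I_n] r.

(** The contribution of the loops of length [m.+1] through one of [n.+1] points,
    hence the reversed parity. *)
Definition loop_term (g : nat -> nat -> nat) n r m :=
  (if odd m then 1 else m.+1) * n ^_ m *
  (if odd m then g (n - m) r else if r is r'.+1 then g (n - m) r' else 0).

(** The count [g] for smaller sets is a parameter because the induction in
    [num_loop_matchingsE] is what shows that [loop_number] is such a [g]. *)
Lemma num_loop_matchings_rec_card (g : nat -> nat -> nat) (T : finType) (S : {set T}) n r :
    #|S| = n.+1 ->
    (forall (S' : {set T}) r', #|S'| <= n -> num_loop_matchings S' r' = g #|S'| r') ->
  num_loop_matchings S r = \sum_(0 <= m < n.+1) loop_term g n r m.
Proof.
move=> Sn gE; have [z zS] : exists z, z \in S by apply/card_gt0P; rewrite Sn.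
rewrite (num_loop_matchings_rec _ zS) big_ord_recl /= big1 ?add0n; last first.
  by move=> t; rewrite inE tuple0.
have ST : n < #|T| by rewrite -Sn max_card.
rewrite -(big_mkord xpredT (fun m => \sum_(t in rooted m.+1 S z) if ~~ odd m then
   if r is r'.+1 then num_loop_matchings (S :\: [set x in t]) r' else 0
   else num_loop_matchings (S :\: [set x in t]) r)).
have termE m : \sum_(t in rooted m.+1 S z) (if ~~ odd m then
   if r is r'.+1 then num_loop_matchings (S :\: [set x in t]) r' else 0
   else num_loop_matchings (S :\: [set x in t]) r) = loop_term g n r m.
  have cR := card_rooted m zS; rewrite Sn /= in cR; rewrite /loop_term -cR -sum_nat_const.
  apply: eq_bigr => t; rewrite inE => /and4P[ut /allP tS _ _].
  have card_rest : #|S :\: [set x in t]| = n - m.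
    rewrite cardsDS; last by apply/subsetP => x; rewrite inE => /tS.
    by rewrite Sn cardsE (card_uniqP ut) size_tuple subSS.
  have le : n - m <= n by exact: leq_subr.
  by case: (odd m); [|case: (r) => // r']; rewrite gE card_rest.
rewrite (eq_bigr _ (fun m _ => termE m)) (big_cat_nat _ (n := n.+1)) //=.
rewrite [X in _ + X]big_nat_cond [X in _ + X]big1 ?addn0 // => m /andP[/andP[nm _] _].
by rewrite /loop_term ffact_small ?muln0.
Qed.

(** The recurrence sees only the size of [S], so it gives the same number in [T]
    and in ['I_#|S|]. *)
Lemma num_loop_matchingsE (T : finType) (S : {set T}) r :
  num_loop_matchings S r = loop_number #|S| r.
Proof.
have [N] := ubnP #|S|; elim: N => // N IH in T S r *; rewrite ltnS => SN.
case Sn: #|S| => [|n].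
  move/eqP: Sn; rewrite cards_eq0 => /eqP ->.
  by rewrite /loop_number (_ : setT = set0) ?num_loop_matchings_set0 //; apply/setP => -[].
rewrite /loop_number !(@num_loop_matchings_rec_card loop_number _ _ n) ?cardsT ?card_ord //.
all: move=> S' r' le.
all: by apply: IH; apply: leq_ltn_trans le _; rewrite -Sn.
Qed.

Lemma loop_number_rec n r : loop_number n.+1 r = \sum_(0 <= m < n.+1) loop_term loop_number n r m.
Proof.
by apply: num_loop_matchings_rec_card => [|S' r' _]; rewrite ?cardsT ?card_ord ?num_loop_matchingsE.
Qed.

Lemma loop_number_small n r : n < r -> loop_number n r = 0.
Proof.
move=> nr; apply/eqP; rewrite cards_eq0; apply/eqP/setP => f; rewrite !inE.
apply/negP => /andP[_ /eqP tr]; move: nr.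
by rewrite -tr ltnNge (leq_trans (max_card _)) ?card_ord.
Qed.

Lemma loop_number_diag n : loop_number n n = 1.
Proof.
elim: n => [|n IH].
  by rewrite /loop_number (_ : setT = set0) ?num_loop_matchings_set0 //; apply/setP => -[].
rewrite loop_number_rec big_nat_recl // {1}/loop_term /= ffactn0 subn0 IH.
rewrite big_nat_cond big1 // => m /andP[/andP[_ mn] _].
by rewrite /loop_term; case: ifP => _; rewrite loop_number_small ?muln0 //; lia.
Qed.

(** The loops of length [2] contribute [n.+1 * loop_number n 0].  In the terms of
    the longer ones the factor [n.+1 * n] splits off from the falling factorial,
    and what is left is the recurrence for [loop_number n 0]. *)
Lemma loop_number_0_rec n : loop_number n.+2 0 = n.+1 ^ 2 * loop_number n 0.
Proof.
rewrite loop_number_rec big_nat_recl // big_nat_recl // {1 2}/loop_term /= muln0 add0n.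
rewrite ffactn1 subSS subn0 mul1n.
have -> : \sum_(0 <= m < n) loop_term loop_number n.+1 0 m.+2 = n.+1 * n * loop_number n 0.
  case: n => [|n]; first by rewrite big_geq ?muln0.
  rewrite loop_number_rec big_distrr; apply: eq_bigr => m _.
  rewrite /loop_term /= negbK !ffactSS !subSS.
  by case: (odd m); rewrite ?muln0 // !mul1n !mulnA.
by rewrite -mulnDl; congr (_ * _); lia.
Qed.

Lemma loop_number_0 n : loop_number n 0 = if odd n then 0 else dfact n.-1 ^ 2.
Proof.
have [N] := ubnP n; elim: N => // N IH in n *; case: n => [_|[_|n nN]].
- exact: loop_number_diag.
- by rewrite loop_number_rec big_nat1 /loop_term /= muln0.
rewrite loop_number_0_rec IH /=; last by lia.
rewrite negbK; case: ifP => _; first by rewrite muln0.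
by case: n {nN} => // k; rewrite -expnMn.
Qed.

Lemma sum_nat_parity (h : nat -> nat) n : 0 < n ->
  \sum_(0 <= m < n) h m = \sum_(1 <= i < (n %/ 2).+1) h (2 * i - 1)
                        + \sum_(0 <= i < ((n - 1) %/ 2).+1) h (2 * i).
Proof.
case: n => // n _; elim: n => [|n IH].
  by rewrite subnn div0n [X in _ = X + _]big_geq // !big_nat1.
rewrite big_nat_recr // IH; have [on|en] := boolP (odd n.+1).
  have [-> ->] : (n.+2 %/ 2 = (n.+1 %/ 2).+1 /\ (n.+2 - 1) %/ 2 = (n.+1 - 1) %/ 2) by lia.
  rewrite [in RHS]big_nat_recr //= addnAC; congr (_ + h _ + _); lia.
have [-> ->] : (n.+2 %/ 2 = n.+1 %/ 2 /\ (n.+2 - 1) %/ 2 = ((n.+1 - 1) %/ 2).+1) by lia.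
rewrite [X in _ = _ + X]big_nat_recr //= addnA; congr (_ + h _); lia.
Qed.

Lemma loop_number_rec_parity n r : 0 < n -> 0 < r ->
  loop_number n r =
    \sum_(1 <= i < (n %/ 2).+1)
      'C(n - 1, 2 * i - 1) * (2 * i - 1)`! * loop_number (n - 2 * i) r
    + \sum_(0 <= i < ((n - 1) %/ 2).+1)
      'C(n - 1, 2 * i) * (2 * i + 1)`! * loop_number (n - 2 * i - 1) (r - 1).
Proof.
case: n r => // n [//|r] _ _; rewrite loop_number_rec sum_nat_parity // !subSS !subn0.
congr (_ + _).
  apply: eq_big_nat => i /andP[i0 _]; rewrite /loop_term bin_ffact.
  have -> : odd (2 * i - 1) by lia.
  by rewrite mul1n; congr (_ * loop_number _ _); lia.
apply: eq_bigr => i _; rewrite /loop_term addn1 factS mulnCA bin_ffact.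
have -> : odd (2 * i) = false by lia.
by congr (_ * loop_number _ _); lia.
Qed.

(** * Idempotents of the Brauer monoid *)

Section Brauer.
Variable n : nat.
Implicit Types (x y : 'I_n + 'I_n) (f g : {ffun 'I_n + 'I_n -> 'I_n + 'I_n}).

Lemma is_upperE y : is_upper (y : vertex n) = ~~ lower y. Proof. by case: y. Qed.

Definition blocks f : {set {set vertex n}} := [set [set y; f y] | y in [set: vertex n]].

Notation adj f := (graph_adj (blocks f) (blocks f)).

Lemma set2_eqP (U : finType) (a b c d : U) : [set a; b] = [set c; d] ->
  (a = c /\ b = d) \/ (a = d /\ b = c).
Proof.
move=> E; have := set21 a b; have := set22 a b; rewrite E !inE.
have := set21 c d; have := set22 c d; rewrite -E !inE.
by do 4![case/orP=> /eqP ?]; subst; auto.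
Qed.

Lemma first_copy_edge f y : adj f (lower_to_mid y) (lower_to_mid (f y)).
Proof.
apply/setUP; left; apply/imsetP; exists [set y; f y]; first exact: imset_f (in_setT y).
by rewrite imsetU1 imset_set1.
Qed.

Lemma second_copy_edge f y : adj f (upper_to_mid y) (upper_to_mid (f y)).
Proof.
apply/setUP; right; apply/imsetP; exists [set y; f y]; first exact: imset_f (in_setT y).
by rewrite imsetU1 imset_set1.
Qed.

Lemma adj_ind f (P : gvertex n -> gvertex n -> Prop) : involutive f ->
    (forall y, P (lower_to_mid y) (lower_to_mid (f y))) ->
    (forall y, P (upper_to_mid y) (upper_to_mid (f y))) ->
  forall u w, adj f u w -> P u w.
Proof.
move=> fK Pl Pu u w /setUP[] /imsetP[_ /imsetP[y _ ->]].
  by rewrite imsetU1 imset_set1 => /set2_eqP[] [-> ->] //; rewrite -{2}(fK y).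
by rewrite imsetU1 imset_set1 => /set2_eqP[] [-> ->] //; rewrite -{2}(fK y).
Qed.

Lemma adj_sym f : connect_sym (adj f).
Proof. by apply: sym_connect_sym => u w; rewrite /graph_adj setUC. Qed.

(** An edge inside the lower row is seen by the middle row in the first copy,
    and one inside the upper row in the second copy. *)
Lemma middle_edge f y : ~~ crossing f y -> adj f (inr (label y)) (inr (label (f y))).
Proof.
rewrite negbK; have := first_copy_edge f y; have := second_copy_edge f y.
by case: y => x; case: (f _) => z.
Qed.

Lemma exit_edge f y : crossing f y -> adj f (inr (label y)) (inl (f y)).
Proof.
have := first_copy_edge f y; have := second_copy_edge f y; rewrite /crossing.
by case: y => x; case: (f _) => z.
Qed.

Lemma outer_edge f y : ~~ crossing f y -> adj f (inl y) (inl (f y)).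
Proof.
rewrite negbK; have := first_copy_edge f y; have := second_copy_edge f y.
by case: y => x; case: (f _) => z.
Qed.

(** If the walk from [x] meets no transversal, it closes up to an even loop.
    Otherwise start at the upper end [c] of a transversal of that cycle and walk
    to the next crossing edge.  In the product graph the walk is a path in the
    middle row; it starts from the lower vertex [f c] and leaves at the far end of
    that crossing edge.  Idempotency allows only [c] or [f c] as exit.  The exit
    [f c] would mean that the walk has reached [swap c], against
    [walk_neq_swap]; so the walk has returned to [c] and is an odd loop. *)
Lemma looped_of_idempotent f : matching setT f ->
    (forall x y, connect (adj f) (inl x) (inl y) -> y \in [set x; f x]) ->
  looped setT f.
Proof.
move=> mf idem; have fK := matchingK mf; apply/loopedP => x _.
have [m m0 [ym my]] := walk_period (inl x) fK.
have [/existsP[k crk]|ncr] :=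
  boolP [exists k : 'I_m, crossing f (iter k (walk f) (inl x))]; last first.
  have [|s [xs ls _]] := walk_loop mf (in_setT x) m0 ym; last by exists s.
  move=> i im; rewrite my // andbT; apply: contra ncr => cr.
  have im' : i < m by case/andP: im.
  by apply/existsP; exists (Ordinal im').
have [c crc cE] : exists2 c : 'I_n, crossing f (inl c)
    & iter k (walk f) (inl x) = inl c \/ iter k (walk f) (inl x) = f (inl c).
  move: crk; case: (iter _ _ _) => c; first by exists c => //; left.
  move=> cr; have := cr; rewrite /crossing; case E: (f (inr c)) => [c'|//] _.
  by exists c'; [rewrite -E fK eq_sym | right; rewrite -E fK].
suff [s cs ls] : exists2 s : seq 'I_n, c \in s & loop s f.
  exists s => //; have cl i : label (iter i (walk f) (inl x)) \in s -> x \in s.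
    elim: i => //= i IH /(loop_closed ls); rewrite /walk fK label_swap; exact: IH.
  apply: (cl k); case: cE => ->; first by [].
  exact: (loop_closed ls).
(* [j] is the number of steps from [c] to the first crossing edge. *)
pose w i := iter i (walk f) (inl c).
have [p p0 [wp _]] := walk_period (inl c) fK.
pose P j := (0 < j) && crossing f (w j).
have exP : exists j, P j by exists p; rewrite /P p0 /w wp.
case: (ex_minnP exP) => j /andP[j0 crj] minj.
have ncr i : 0 < i < j -> ~~ crossing f (w i).
  by move=> /andP[i0 ij]; apply: contraTN ij => cr; rewrite -leqNgt minj // /P i0.
have low i : i < j -> lower (w i) = odd i by apply: lower_walk.
have conn i : i < j -> connect (adj f) (inr c) (inr (label (w i))).
  elim: i => [|i IH] ij; first exact: connect0.
  apply: connect_trans (IH (ltnW ij)) (connect1 _).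
  have := @middle_edge f (swap (w i)); rewrite label_swap -crossing_f //; apply.
  exact: (ncr i.+1).
have wj : w j = f (swap (w j.-1)) by rewrite -{1}(prednK j0).
have : w j \in [set f (inl c); f (f (inl c))].
  apply: idem; apply: (connect_trans (y := inr c)).
    by rewrite adj_sym; apply: connect1; apply: (exit_edge crc).
  apply: connect_trans (conn j.-1 _) (connect1 _); first by rewrite prednK.
  rewrite wj; have := @exit_edge f (swap (w j.-1)); rewrite label_swap; apply.
  by rewrite -crossing_f // -wj.
(* The exit [c] closes the loop; the exit [f c] is impossible. *)
rewrite fK !inE => /orP[/eqP E|/eqP E]; last first.
  have [|s [cs ls _]] := walk_loop mf (in_setT c) j0 E; last by exists s.
  move=> i ij; rewrite ncr //=; apply: contraNneq (ncr i ij) => iE.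
  by rewrite /w iE.
have {}E : w j.-1 = swap (inl c).
  by apply: (canRL (@swapK _)); apply: (can_inj fK); rewrite -wj.
have jp : j.-1 < j by rewrite prednK.
have := low _ jp; rewrite E /= => /esym oj.
(* [swap c] is in the lower row, so it is reached after an odd number of steps. *)
have /negP[] := @walk_neq_swap _ _ f (j.-1)./2 (inl c) mf (in_setT _).
have -> : ((j.-1)./2).*2.+1 = j.-1 by lia.
by rewrite -E.
Qed.

(** A transversal closes an odd loop, and the other edges of that loop connect
    its two ends through the middle row.  Conversely, [{x, f x}] together with, if
    [x] lies on a transversal, the middle vertices of the loop of [x] is closed
    under adjacency. *)
Lemma connect_of_looped f x y : matching setT f -> looped setT f ->
  connect (adj f) (inl x) (inl y) = (y \in [set x; f x]).
Proof.
move=> mf lf; have fK := matchingK mf; apply/idP/idP; last first.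
  rewrite !inE => /orP[/eqP -> //|/eqP ->]; have [crx|] := boolP (crossing f x); last first.
    by move=> nc; apply/connect1/outer_edge.
  have [s xs ls] := loopedP _ _ lf (label x) (in_setT _).
  have [_ xE] := crossing_loop_head (label x) ls xs crx.
  set h := head (label x) s in xE.
  have crh : crossing f (inl h) by case: xE crx => ->; rewrite ?crossing_f.
  suff cn : connect (adj f) (inl (inl h)) (inl (f (inl h))).
    by case: xE => ->; rewrite ?fK // adj_sym.
  have hs : h \in s by rewrite /h -nth0 mem_nth //; case: (s) xs.
  have conn k : k \in s -> connect (adj f) (inr h) (inr k).
    move=> ks; have := @loop_sub_closed _ f s (fun k => connect (adj f) (inr h) (inr k)) h fK.
    apply=> // z nc; move/connect_trans; apply; apply: connect1; exact: middle_edge.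
  apply: (connect_trans (y := inr h)); last first.
    by apply/connect1; apply: (exit_edge crh).
  rewrite adj_sym; apply: connect_trans (conn (label (f (inl h))) _) (connect1 _).
    exact: (loop_closed ls).
  by have := @exit_edge f (f (inl h)); rewrite crossing_f // fK; apply.
have [s xs ls] := loopedP _ _ lf (label x) (in_setT _).
pose A (u : gvertex n) := match u with
  | inl z => z \in [set x; f x] | inr k => crossing f x && (k \in s) end.
have clA : closed (adj f) A.
  have pair z : (f z \in [set x; f x]) = (z \in [set x; f x]).
    by rewrite !inE (inv_eq fK) (can_eq fK) orbC.
  have lab z : (label (f z) \in s) = (label z \in s).
    by apply/idP/idP => /(loop_closed ls) //; rewrite fK.
  have cr z : z \in [set x; f x] -> crossing f z = crossing f x.
    by rewrite !inE => /orP[] /eqP -> //; apply: crossing_f.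
  (* A loop has only one transversal. *)
  have key z : crossing f z -> (z \in [set x; f x]) = crossing f x && (label z \in s).
    move=> crz; apply/idP/andP => [zx|[crx zs]].
      rewrite -(cr _ zx) crz; split=> //; move: zx; rewrite !inE => /orP[] /eqP -> //.
      by rewrite lab.
    have [_ xE] := crossing_loop_head (label x) ls xs crx.
    have [_ zE] := crossing_loop_head (label x) ls zs crz.
    by case: xE => {1 2}->; case: zE => ->; rewrite !inE ?fK eqxx ?orbT.
  have AL z : A (lower_to_mid z) =
      if lower z then crossing f x && (label z \in s) else z \in [set x; f x].
    by case: z.
  have AU z : A (upper_to_mid z) =
      if lower z then z \in [set x; f x] else crossing f x && (label z \in s).
    by case: z.
  have alt z : crossing f z \/ lower (f z) = lower z.
    by rewrite /crossing; case: eqP; [right | left].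
  apply: (adj_ind fK) => z.
    rewrite -[LHS]/(A (lower_to_mid z)) -[RHS]/(A (lower_to_mid (f z))) !AL.
    case: (alt z) => [crz|->]; last by rewrite pair lab.
    by rewrite -(key z) // -(key (f z)) ?crossing_f // pair !if_same.
  rewrite -[LHS]/(A (upper_to_mid z)) -[RHS]/(A (upper_to_mid (f z))) !AU.
  case: (alt z) => [crz|->]; last by rewrite pair lab.
  by rewrite -(key z) // -(key (f z)) ?crossing_f // pair !if_same.
move=> xy.
have : (x \in [set x; f x]) = (y \in [set x; f x]) := closed_connect clA xy.
by rewrite set21 => <-.
Qed.

(** * Brauer elements as involutions *)

Lemma matching_neq f y : matching setT f -> f y != y.
Proof. by move=> mf; rewrite (matching_fix _ mf) inE. Qed.

Lemma blocksE f : involutive f ->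
  blocks f = equivalence_partition (fun x y => y \in [set x; f x]) [set: vertex n].
Proof.
move=> fK; apply: eq_imset => y; apply/setP => z.
by rewrite [RHS]inE in_setT.
Qed.

Lemma blocks_equiv f : involutive f ->
  {in [set: vertex n] & &, equivalence_rel (fun x y => y \in [set x; f x])}.
Proof.
move=> fK x y z _ _ _; rewrite set21; split=> //.
by rewrite inE => /orP[] /set1P ->; rewrite // fK setUC.
Qed.

Lemma pblock_blocks f y : involutive f -> pblock (blocks f) y = [set y; f y].
Proof.
move=> fK; apply/setP => z; rewrite blocksE //.
by rewrite (pblock_equivalence_partition (blocks_equiv fK)) ?inE.
Qed.

Lemma blocks_inj f g : involutive f -> involutive g -> (forall y, f y != y) ->
  blocks f = blocks g -> f = g.
Proof.
move=> fK gK nf E; apply/ffunP => y.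
have := pblock_blocks y fK; rewrite E pblock_blocks // => /setP /(_ (f y)).
by rewrite set22 !inE (negPf (nf y)) => /eqP.
Qed.

Lemma blocks_brauer f : matching setT f -> blocks f \in brauer n.
Proof.
move=> mf; have fK := matchingK mf; rewrite inE; apply/andP; split.
  by rewrite blocksE //; apply/equivalence_partitionP/blocks_equiv.
by apply/forall_inP => _ /imsetP[y _ ->]; rewrite cards2 (eq_sym y) matching_neq.
Qed.

Lemma brauer_blocks a : a \in brauer n -> exists2 f, matching setT f & a = blocks f.
Proof.
rewrite inE => /andP[pa /forall_inP a2]; have /and3P[/eqP ca ta a0] := pa.
have cov y : y \in cover a by rewrite ca inE.
pose f := [ffun y : 'I_n + 'I_n => odflt y [pick z | (z \in pblock a y) && (z != y)]].
have fE y : f y != y /\ pblock a y = [set y; f y].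
  have : #|pblock a y| == 2 by apply: a2; apply: pblock_mem.
  have yB : y \in pblock a y by rewrite mem_pblock.
  rewrite (cardsD1 y) yB => /cards1P[z E].
  have zE w : (w \in pblock a y) && (w != y) = (w == z).
    by have /setP/(_ w) := E; rewrite !inE andbC.
  rewrite /f ffunE; case: pickP => [w|/(_ z)]; last by rewrite zE eqxx.
  move=> wP; have := wP; rewrite zE => /eqP wz; subst w.
  have /andP[_ neq] := wP; split=> //=.
  by rewrite -E setD1K.
have mf : matching setT f.
  apply/forallP => y; have [ny py] := fE y.
  rewrite inE (negPf ny) andbT; have [nfy pfy] := fE (f y).
  have : pblock a (f y) = pblock a y.
    by apply: same_pblock => //; rewrite py set22.
  rewrite py pfy => /setP/(_ y); rewrite !inE eqxx /=.
  by rewrite (eq_sym y) (negPf ny) /= eq_sym.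
exists f => //; rewrite -(equivalence_partition_pblock pa) blocksE ?(matchingK mf) //.
  apply: eq_imset => y; apply/setP => z; rewrite [LHS]inE [RHS]inE.
  by have [_ ->] := fE y.
exact: matchingK mf.
Qed.

Lemma rank_blocks f : matching setT f -> rank (blocks f) = #|transversals f|.
Proof.
move=> mf; have fK := matchingK mf; rewrite /rank.
rewrite -(card_in_imset (f := fun x : 'I_n => [set inl x; f (inl x)])).
  apply: eq_card => B; rewrite inE; apply/idP/imsetP.
    case/and3P => /imsetP[y _ ->] /exists_inP[u uy uu] /exists_inP[v vy vl].
    case: u uu uy => // x _ xy; exists x; last first.
      move: xy; rewrite inE => /orP[] /set1P -> //; by rewrite fK setUC.
    rewrite inE; move: vy vl xy; rewrite !inE is_upperE negbK.
    case/orP=> /eqP -> lv; case/orP=> /eqP E; rewrite ?E ?fK // -?E //.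
    - by rewrite -E in lv.
    - by rewrite -E in lv.
  case=> x; rewrite inE => lx ->; apply/and3P; split; first exact: imset_f (in_setT _).
    by apply/exists_inP; exists (inl x); rewrite ?set21.
  by apply/exists_inP; exists (f (inl x)); rewrite ?set22 // is_upperE negbK.
move=> x y; rewrite !inE => lx ly E; have := set21 (inl x) (f (inl x)); rewrite E !inE.
by case/orP=> /eqP // Ey; [case: Ey | rewrite -Ey in ly].
Qed.

Lemma equivalence_partition_eqP (U : finType) (R1 R2 : rel U) :
    {in [set: U] & &, equivalence_rel R1} -> {in [set: U] & &, equivalence_rel R2} ->
  equivalence_partition R1 setT = equivalence_partition R2 setT -> R1 =2 R2.
Proof.
move=> e1 e2 E x y.
rewrite -(pblock_equivalence_partition e1) ?inE // E.
by rewrite pblock_equivalence_partition ?inE.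
Qed.

Lemma brauer_mul_blocks f : matching setT f ->
  (brauer_mul (blocks f) (blocks f) == blocks f) = looped setT f.
Proof.
move=> mf; have fK := matchingK mf; apply/eqP/idP => [|lf].
  rewrite {3}blocksE // => /equivalence_partition_eqP E.
  apply: looped_of_idempotent => // x y; rewrite E //; last exact: blocks_equiv.
  move=> u v w _ _ _; split=> // uv.
  exact: (same_connect (adj_sym f) uv).
rewrite {3}blocksE //; apply: eq_imset => x; apply/setP => y.
by rewrite !inE connect_of_looped // !inE.
Qed.

Lemma num_idem_brauer_D r : num_idem (brauer_D n r) = loop_number n r.
Proof.
rewrite /num_idem /loop_number /num_loop_matchings -(card_in_imset (f := blocks)); last first.
  move=> f g; rewrite !inE => /andP[/andP[mf _] _] /andP[/andP[mg _] _].
  by apply: blocks_inj; [apply: matchingK mf | apply: matchingK mg | move=> y; apply: matching_neq].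
apply: eq_card => a; rewrite inE; apply/idP/imsetP.
  rewrite inE => /andP[/andP[/brauer_blocks[f mf ->]]].
  rewrite rank_blocks // brauer_mul_blocks // => rf lf; exists f => //.
  by rewrite inE /loop_matching mf lf.
case=> f; rewrite inE => /andP[/andP[mf lf] rf] ->.
by rewrite inE blocks_brauer // rank_blocks // brauer_mul_blocks // rf.
Qed.

End Brauer.

Theorem theorem21 (n : nat) :
  [/\ num_idem (brauer_D n n) = 1,
      num_idem (brauer_D n 0) = (if odd n then 0 else dfact n.-1 ^ 2)
    & forall r : nat, 1 <= n -> 1 <= r <= n - 1 ->
      num_idem (brauer_D n r) =
        \sum_(1 <= i < (n %/ 2).+1)
          'C(n - 1, 2 * i - 1) * (2 * i - 1)`! * num_idem (brauer_D (n - 2 * i) r)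
        + \sum_(0 <= i < ((n - 1) %/ 2).+1)
          'C(n - 1, 2 * i) * (2 * i + 1)`!
            * num_idem (brauer_D (n - 2 * i - 1) (r - 1))].
Proof.
split; rewrite ?num_idem_brauer_D; [exact: loop_number_diag | exact: loop_number_0 |].
move=> r n0 /andP[r0 _]; rewrite num_idem_brauer_D loop_number_rec_parity //.
by congr (_ + _); apply: eq_bigr => i _; rewrite num_idem_brauer_D.
Qed.
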